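(* Let $I$ be a countable set. Then the uniform measure $\lambda$ is the unique fully supported balanced Borel probability measure on the cube $\{0,1\}^I$.
   Context: Countable sets may be finite or empty. The set $\{0,1\}$ carries the standard (majority) median operation, and $M=\{0,1\}^I$ carries the coordinate-wise majority operation $m:M^3\to M$ and the product topology. The uniform measure on $\{0,1\}^I$ is the product measure $\lambda=(\tfrac12\delta_0+\tfrac12\delta_1)^I$. A Borel probability measure $\mu$ on $M$ is balanced if $m_*(\mu^3)=\mu$, where $\mu^3=\mu\otimes\mu\otimes\mu$. It is fully supported if its support (the minimal closed set with null complement) is all of $M$. *)

(* Defs.v *)
From HB Require Import structures.
From mathcomp Require Import all_boot all_order all_algebra finmap.
From mathcomp Require Import all_classical all_reals all_analysis.

Set Implicit Arguments.
Unset Strict Implicit.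
Unset Printing Implicit Defensive.

Import Order.TTheory GRing.Theory Num.Theory.
Local Open Scope classical_set_scope.
Local Open Scope ring_scope.

(* The points 0 and 1 are [false] and [true]; [bool] is discrete in the
   library, and [prod_topology] is the topology of pointwise convergence. *)
Definition cube (I : Type) : Type := prod_topology (fun _ : I => bool).

HB.instance Definition _ (I : Type) := Pointed.copy (cube I) (I -> bool).
HB.instance Definition _ (I : Type) := Nbhs.on (cube I).
HB.instance Definition _ (I : Type) := Topological.on (cube I).

Definition borel_cube (I : Type) : measurableType _ :=
  g_sigma_algebraType (@open (cube I)).

Definition maj (a b c : bool) : bool := [|| a && b, b && c | a && c].

Definition cube_maj (I : Type) (p : borel_cube I * borel_cube I * borel_cube I)
  : borel_cube I := fun i => maj (p.1.1 i) (p.1.2 i) (p.2 i).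

Section Measures.
Context {R : realType}.
Local Open Scope ereal_scope.

Definition balanced (I : Type) (mu : probability (borel_cube I) R) : Prop :=
  forall A : set (borel_cube I), measurable A ->
    pushforward (mu \x mu \x mu) (@cube_maj I) A = mu A.

Definition is_support (I : Type) (mu : probability (borel_cube I) R)
    (S : set (cube I)) : Prop :=
  [/\ closed S, mu (~` S) = 0 &
      forall C : set (cube I), closed C -> mu (~` C) = 0 -> S `<=` C].

Definition fully_supported (I : Type) (mu : probability (borel_cube I) R)
  : Prop := is_support mu [set: cube I].

(* mu is the product of copies of nu: on a box with finitely many constrained
   coordinates it is the product of the nu-masses of the sides. Every subset of
   [bool] is measurable, so the sides are arbitrary. *)
Definition is_power_measure (I : choiceType) (nu : probability bool R)
    (mu : probability (borel_cube I) R) : Prop :=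
  forall (F : {fset I}) (A : I -> set bool),
    mu [set x : borel_cube I | forall i, i \in F -> A i (x i)]
    = \prod_(i <- F) nu (A i).

(* By [bernoulli_dirac], [bernoulli_prob 2^-1] is (1/2) d_0 + (1/2) d_1. *)
Definition is_uniform (I : choiceType) (mu : probability (borel_cube I) R)
  : Prop := is_power_measure (bernoulli_prob (2^-1)%R) mu.

End Measures.

(* Main.v *)
From HB Require Import structures.
Require Import Defs.
From mathcomp Require Import all_boot all_order all_algebra finmap.
From mathcomp Require Import all_classical all_reals all_analysis.
From mathcomp Require Import ring lra zify.

(** A Borel measure on the cube is determined by the masses of its cylinders
    (the sets cut out by prescribing finitely many coordinates), and the
    majority operation acts coordinatewise. Balancedness therefore says exactly
    that for every finite set F of coordinates the weight a |-> mu (cylinder a)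
    on {0,1}^F is fixed by the push-forward of its third power under majority
    ([pushforward_maj_cylinder]), and full support says that all these weights
    are positive. Everything reduces to a positive fixed weight p of mass 1 on a
    finite cube, which has to be uniform.

    Uniqueness is Fourier analysis on the finite cube, that is, on the group
    (Z/2)^T. In terms of signs, majority is (a + b + c - abc) / 2. Hence the
    Fourier coefficient of p at S is a combination of triple products of
    coefficients at subsets of S ([fourier_balanced]). If S is nonempty and the
    coefficients at its nonempty proper subsets vanish, what remains is an
    equation for the single number h, the coefficient at S, with s = #|S|:
      2^s h = 3 h + (-1)^s h^3      ([fourier_first]).
    A nonzero solution has 2^s = 3 +- h^2, and positivity of p gives |h| < 1
    ([fourier_lt1]); so 2 < 2^s < 4, which no s satisfies. By induction on S all
    coefficients but the one at the empty set vanish, and Fourier inversion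
    makes p constant ([balanced_weight_uniform]).

    That the uniform weight is a fixed point is a count done one coordinate at a
    time: four of the eight values of (b, c, d) have a given majority
    ([uniform_weight_balanced]).

    The uniform measure itself is obtained as the law of the binary digits of a
    uniform point of [0,1[: prescribing the first n digits leaves a dyadic
    interval of length 2^-n ([digits_fiber]). A coordinate i of the cube reads
    the digit whose rank is the code of i in the countable type I. *)

Set Implicit Arguments.
Unset Strict Implicit.
Unset Printing Implicit Defensive.

Import Order.TTheory GRing.Theory Num.Theory.
Local Open Scope ring_scope.

(** * Fourier analysis of balanced weights on a finite cube *)

Section FiniteCube.
Variables (R : realType) (T : finType).
Implicit Types (p : {ffun T -> bool} -> R) (S X : {set T}).
Implicit Types (u v w a : {ffun T -> bool}).

Definition character S u : R := \prod_(i in S) (-1) ^+ u i.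

Definition fourier p S : R := \sum_u p u * character S u.

Definition ffun_maj u v w : {ffun T -> bool} :=
  [ffun i => maj (u i) (v i) (w i)].

Definition balanced_weight p := forall a,
  \sum_u \sum_v \sum_(w | ffun_maj u v w == a) p u * p v * p w = p a.

(** The Fourier coefficients of majority on three signs: a triple says which of
    the three variables occur in the monomial. *)
Definition maj_coef (c : bool * bool * bool) : R :=
  match c with
  | (true, false, false) | (false, true, false) | (false, false, true) => 2^-1
  | (true, true, true) => - 2^-1
  | _ => 0
  end.

Lemma sum_bool3 (F : bool * bool * bool -> R) :
  \sum_c F c =
  F (true, true, true) + F (true, true, false) + F (true, false, true)
  + F (true, false, false) + F (false, true, true) + F (false, true, false)
  + F (false, false, true) + F (false, false, false).
Proof.
transitivity (\sum_a \sum_b \sum_d F (a, b, d)).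
  by rewrite pair_bigA pair_bigA; apply: eq_bigr => -[[]].
by rewrite !big_bool /= !addrA.
Qed.

Lemma sign_majE (a b d : bool) :
  (-1) ^+ maj a b d = \sum_c maj_coef c *
    (((-1) ^+ a) ^+ c.1.1 * ((-1) ^+ b) ^+ c.1.2 * ((-1) ^+ d) ^+ c.2).
Proof.
rewrite sum_bool3.
by case: a; case: b; case: d; rewrite /= ?expr1 ?expr0; field.
Qed.

(** Multiplying out the product over S of the expansions of majority: the map f
    chooses a monomial for each coordinate in S, and collecting the coordinates
    by variable gives one character in each of u, v and w. *)
Lemma character_maj S u v w : character S (ffun_maj u v w) =
  \sum_(f in pffun_on (false, false, false) (mem S) predT)
    (\prod_(i in S) maj_coef (f i)) *
    (character [set i in S | (f i).1.1] u *
     character [set i in S | (f i).1.2] v *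
     character [set i in S | (f i).2] w).
Proof.
have charE (b : T -> bool) x : character [set i in S | b i] x =
    \prod_(i in S) ((-1) ^+ x i) ^+ b i.
  rewrite /character [LHS]big_mkcond [RHS]big_mkcond/=.
  by apply: eq_bigr => i _; rewrite inE; case: (i \in S); case: (b i).
rewrite /character; under eq_bigr do rewrite ffunE sign_majE.
rewrite (big_distr_big (false, false, false))/=; apply: eq_bigr => f _.
by rewrite -!/(character _ _) !charE -!big_split.
Qed.

(** Under the third power of p the three variables are independent, so each
    character of [character_maj] integrates to a Fourier coefficient of p. *)
Lemma fourier_balanced p S : balanced_weight p -> fourier p S =
  \sum_(f in pffun_on (false, false, false) (mem S) predT)
    (\prod_(i in S) maj_coef (f i)) *
    (fourier p [set i in S | (f i).1.1] *
     fourier p [set i in S | (f i).1.2] *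
     fourier p [set i in S | (f i).2]).
Proof.
move=> bp.
transitivity (\sum_u \sum_v \sum_w
    p u * p v * p w * character S (ffun_maj u v w)).
  rewrite /fourier; under eq_bigr => a _ do rewrite -bp mulr_suml.
  rewrite exchange_big; apply: eq_bigr => u _ /=.
  under eq_bigr => a _ do rewrite mulr_suml.
  rewrite exchange_big; apply: eq_bigr => v _ /=.
  under eq_bigr => a _ do rewrite mulr_suml big_mkcond/=.
  rewrite exchange_big; apply: eq_bigr => w _ /=.
  by rewrite -big_mkcond/= (big_pred1 (ffun_maj u v w))// => a; rewrite eq_sym.
under eq_bigr => u _.
  under eq_bigr => v _.
    under eq_bigr => w _ do rewrite character_maj mulr_sumr.
    rewrite exchange_big; over.
  rewrite exchange_big; over.
rewrite exchange_big; apply: eq_bigr => f _ /=.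
have tri (r1 r2 r3 : {ffun T -> bool} -> R) :
    (\sum_u r1 u) * (\sum_v r2 v) * (\sum_w r3 w) =
    \sum_u \sum_v \sum_w r1 u * r2 v * r3 w.
  rewrite big_distrlr mulr_suml; apply: eq_bigr => u _ /=.
  by rewrite mulr_suml; apply: eq_bigr => v _; rewrite mulr_sumr.
rewrite /fourier tri mulr_sumr; apply: eq_bigr => u _.
rewrite mulr_sumr; apply: eq_bigr => v _.
by rewrite mulr_sumr; apply: eq_bigr => w _; ring.
Qed.

Lemma fourier0 p : fourier p finset.set0 = \sum_u p u.
Proof. by apply: eq_bigr => u _; rewrite /character finset.big_set0 mulr1. Qed.

(** In [fourier_balanced], a choice f that is not constant on S makes one of the
    three subsets nonempty and proper, which kills its term. Of the eight
    constant choices, the three single variables contribute 2^-s h each, the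
    product of all three (-1/2)^s h^3, and the others have coefficient 0. *)
Lemma fourier_first p S : balanced_weight p -> \sum_u p u = 1 ->
  S != finset.set0 ->
  (forall X, X \proper S -> X != finset.set0 -> fourier p X = 0) ->
  2 ^+ #|S| * fourier p S =
  3 * fourier p S + (-1) ^+ #|S| * fourier p S ^+ 3.
Proof.
move=> bp p1 S0 properS; set h := fourier p S.
have subS (b : T -> bool) : fourier p [set i in S | b i] != 0 ->
    (forall i, i \in S -> b i) \/ (forall i, i \in S -> ~~ b i).
  have [/eqP XS|XS] := boolP ([set i in S | b i] == S).
    by left => i iS; move/finset.setP/(_ i): XS; rewrite inE iS.
  have [/eqP X0|X0] := boolP ([set i in S | b i] == finset.set0).
    by right => i iS; move/finset.setP/(_ i): X0; rewrite !inE iS /= => ->.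
  rewrite properS ?eqxx // finset.properEneq XS.
  by rewrite finset.setIdE finset.subsetIl.
pose cst (c : bool * bool * bool) : {ffun T -> bool * bool * bool} :=
  [ffun i => if i \in S then c else (false, false, false)].
have [i0 i0S] := finset.set0Pn _ S0.
have fS c : fourier p [set i in S | c] = h ^+ c.
  case: c.
    by rewrite expr1; congr fourier; apply/finset.setP => i; rewrite inE andbT.
  rewrite expr0 -p1 -fourier0; congr fourier.
  by apply/finset.setP => i; rewrite !inE andbF.
have hE : h = \sum_c maj_coef c ^+ #|S| *
    (h ^+ c.1.1 * h ^+ c.1.2 * h ^+ c.2).
  rewrite {1}/h fourier_balanced //.
  rewrite (bigID (fun f : {ffun T -> bool * bool * bool} => f == cst (f i0))).
  rewrite /= [X in _ + X]big1 ?addr0; last first.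
    move=> f /andP[/pffun_onP[/fintype.subsetP fsupp _] fcst].
    apply/eqP; rewrite mulf_eq0; apply/orP; right; apply: contraNT fcst.
    rewrite !mulf_eq0 !negb_or -andbA => /and3P[/subS h1 /subS h2 /subS h3].
    apply/eqP/ffunP => i; rewrite ffunE; case: ifPn => iS; last first.
      by apply/eqP/negPn; apply: contra iS => fi; apply: fsupp.
    have eqi (b : T -> bool) : (forall i, i \in S -> b i) \/
      (forall i, i \in S -> ~~ b i) -> b i = b i0.
      case=> bS; first by rewrite !bS.
      by rewrite (negbTE (bS _ iS)) (negbTE (bS _ i0S)).
    move: (eqi _ h1) (eqi _ h2) (eqi _ h3).
    by case: (f i) (f i0) => [[? ?] ?] [[? ?] ?] /= -> -> ->.
  rewrite (reindex_onto cst (fun f : {ffun T -> bool * bool * bool} => f i0));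
    last by move=> f /andP[_ /eqP].
  apply: eq_big => [c|c _].
    rewrite !ffunE i0S !eqxx !andbT; apply/pffun_onP; split=> //.
    apply/fintype.subsetP => i; apply: contraR => iS; rewrite /= ffunE.
    by rewrite (negbTE iS).
  rewrite -prodr_const -!fS; congr (_ * (_ * _ * _));
    try by apply: eq_bigr => i iS; rewrite ffunE iS.
  - by congr fourier; apply/finset.setP => i; rewrite !inE ffunE; case: ifP.
  - by congr fourier; apply/finset.setP => i; rewrite !inE ffunE; case: ifP.
  - by congr fourier; apply/finset.setP => i; rewrite !inE ffunE; case: ifP.
move: hE; rewrite sum_bool3 /= !expr0n cards_eq0 (negbTE S0).
rewrite !(mul0r, addr0, add0r).
rewrite !(expr0, expr1, mulr1, mul1r) => {1}->.
rewrite (exprNn 2^-1) exprVn; set e := (-1) ^+ _.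
have : (2 : R) ^+ #|S| != 0 by rewrite expf_neq0 // pnatr_eq0.
by move: (2 ^+ _) e => d e d0; field.
Qed.

(** The character of S takes both signs, and p charges every point. *)
Lemma fourier_lt1 p S : (forall u, 0 < p u) -> \sum_u p u = 1 ->
  S != finset.set0 -> `|fourier p S| < 1.
Proof.
move=> p0 p1 /finset.set0Pn[i iS].
have cS u : character S u = 1 \/ character S u = -1.
  rewrite /character; elim/big_ind: _ => [|x y|j _]; first by left.
    by move=> [] -> [] ->; rewrite ?mulrNN ?mul1r ?mulr1; auto.
  by case: (u j); rewrite ?expr0 ?expr1; auto.
rewrite ltr_norml -p1 /fourier -sumrN.
(* Both signs are attained: flip one coordinate of S. *)
have flip (b : bool) : exists u, character S u = (-1) ^+ b.
  exists [ffun j => (j == i) && b]; rewrite /character (bigD1 i) //= big1.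
    by rewrite ffunE eqxx mulr1.
  by move=> j /andP[_ /negbTE ji]; rewrite ffunE ji.
have le (u : {ffun T -> bool}) :
    (- p u <= p u * character S u) && (p u * character S u <= p u).
  have := p0 u; have [] := cS u => -> ?; lra.
have [u1 cu1] := flip true; have [u0 cu0] := flip false.
apply/andP; split.
  rewrite (bigD1 u0) // [ltRHS](bigD1 u0) //=; apply: ltr_leD.
    by have := p0 u0; rewrite cu0 expr0; lra.
  by apply: ler_sum => u _; case/andP: (le u).
rewrite (bigD1 u1) // [ltRHS](bigD1 u1) //=; apply: ltr_leD.
  by have := p0 u1; rewrite cu1 expr1; lra.
by apply: ler_sum => u _; case/andP: (le u).
Qed.

Lemma fourier_eq0 p S : (forall u, 0 < p u) -> \sum_u p u = 1 ->
  balanced_weight p -> S != finset.set0 -> fourier p S = 0.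
Proof.
move=> p0 p1 bp; have [n] := ubnP #|S|; elim: n S => // n IH S /ltnSE Sn S0.
have := fourier_first bp p1 S0 _; set h := fourier p S => hE.
have {hE} : 2 ^+ #|S| * h = 3 * h + (-1) ^+ #|S| * h ^+ 3.
  apply: hE => X XS; apply: IH.
  by apply: leq_trans (proper_card XS) Sn.
have h1 : h ^+ 2 < 1.
  by rewrite -real_normK ?num_real// expr_lt1 ?normr_ge0 ?fourier_lt1.
have h2 : 0 <= h ^+ 2 by rewrite sqr_ge0.
have [->//|hn0] := eqVneq h 0.
rewrite exprSr mulrA -mulrDl => /(mulIf hn0).
(* Dividing by h leaves 2^s = 3 + (-1)^s h^2: for s = 1 this forces h^2 = 1,
   and for s >= 2 the left side is at least 4. *)
have := S0; rewrite -cards_eq0; case: #|S| => [|[|s]] // _.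
  by rewrite !expr1 => ?; lra.
have : (1 : R) <= 2 ^+ s by rewrite exprn_ege1 // ler1n.
by rewrite -signr_odd !exprS; case: odd; rewrite ?expr0 ?expr1 => ? ?; lra.
Qed.

(** The characters, summed over S, factor into a product over coordinates which
    vanishes as soon as u and a differ somewhere. *)
Lemma fourier_inversion p a :
  2 ^+ #|T| * p a = \sum_S fourier p S * character S a.
Proof.
under eq_bigr do rewrite mulr_suml.
have orth u : \sum_S p u * character S u * character S a =
    p u * \prod_i ((-1) ^+ u i * (-1) ^+ a i + 1).
  rewrite [in RHS]bigA_distr mulr_sumr; apply: eq_bigr => S _.
  by rewrite -mulrA /character -big_split [in LHS]big_mkcond.
rewrite exchange_big /= (bigD1 a) //= [X in _ + X]big1 ?addr0 => [|u ua].
  rewrite orth mulrC; congr (_ * _); rewrite -prodr_const.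
  by apply: eq_bigr => i _; case: (a i); rewrite ?expr1 ?mulrNN ?mulr1.
rewrite orth; have [i uai] : exists i, u i != a i.
  apply/existsP; apply: contraNT ua; rewrite negb_exists => /forallP ua.
  by apply/eqP/ffunP => i; apply/eqP/negPn.
rewrite (bigD1 i) //=; case: (u i) (a i) uai => [] [] // _;
  by rewrite ?expr0 ?expr1 ?mulr1 ?mul1r addNr mul0r mulr0.
Qed.

Lemma balanced_weight_uniform p : (forall u, 0 < p u) -> \sum_u p u = 1 ->
  balanced_weight p -> forall a, p a = 2^-1 ^+ #|T|.
Proof.
move=> p0 p1 bp a; have T0 : (2 : R) ^+ #|T| != 0 by rewrite expf_neq0.
apply: (mulfI T0); rewrite fourier_inversion exprVn divff //.
rewrite (bigD1 finset.set0) //= big1 ?addr0 => [|S S0].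
  by rewrite fourier0 p1 /character finset.big_set0 mul1r.
by rewrite fourier_eq0 // mul0r.
Qed.

(** The constraint that the majority be a, and the uniform weight, are products
    over the coordinates, so the triple sum is a product of sums over three
    bits. *)
Lemma uniform_weight_balanced : balanced_weight (fun=> 2^-1 ^+ #|T|).
Proof.
move=> a.
(* The weight of a triple is (2^-n)^3, that is 8^-1 for each coordinate. *)
pose G i b c d : R := (maj b c d == a i)%:R * 8^-1.
transitivity (\prod_i \sum_b \sum_c \sum_d G i b c d).
  rewrite bigA_distr_bigA; apply: eq_bigr => u _ /=.
  rewrite bigA_distr_bigA; apply: eq_bigr => v _ /=.
  rewrite bigA_distr_bigA big_mkcond; apply: eq_bigr => w _ /=.
  rewrite /G big_split /= prodr_const.
  have -> : 2^-1 ^+ #|T| * 2^-1 ^+ #|T| * 2^-1 ^+ #|T| = 8^-1 ^+ #|T| :> R.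
    by rewrite -!exprMn; congr (_ ^+ _); field.
  have -> : \prod_i (maj (u i) (v i) (w i) == a i)%:R =
    (ffun_maj u v w == a)%:R :> R.
    case: eqP => [<-|ua]; first by rewrite big1 // => i _; rewrite ffunE eqxx.
    have [i uai] : exists i, maj (u i) (v i) (w i) != a i.
      apply/existsP; apply: contra_notT ua; rewrite negb_exists => /forallP ua.
      by apply/ffunP => i; rewrite ffunE; apply/eqP/negPn.
    by rewrite (bigD1 i) //= (negbTE uai) mul0r.
  by case: ifP; rewrite ?mul1r ?mul0r.
rewrite -prodr_const; apply: eq_bigr => i _.
by rewrite !big_bool /G; case: (a i) => /=; field.
Qed.
End FiniteCube.

(** * Cylinders and the Borel structure of the cube *)

Local Open Scope classical_set_scope.

Section FiniteValued.
Context d (X : measurableType d) (R : realType) (A : finType).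
Variables (mu : {measure set X -> \bar R}) (f : X -> A).
Hypothesis mf : forall a, measurable (f @^-1` [set a]).

Lemma preimage_finE (B : pred A) :
  f @^-1` [set a | B a] = \bigcup_(a in [set a | B a]) f @^-1` [set a].
Proof.
apply/seteqP; split=> [x /= Bx|x [a Ba /= ->]//].
by exists (f x).
Qed.

Lemma measurable_preimage_fin (B : pred A) : measurable (f @^-1` [set a | B a]).
Proof.
by rewrite preimage_finE; apply: fin_bigcup_measurable.
Qed.

Lemma measure_preimage_fin (B : pred A) :
  mu (f @^-1` [set a | B a]) = (\sum_(a | B a) mu (f @^-1` [set a]))%E.
Proof.
rewrite preimage_finE measure_fin_bigcup //; last 2 first.
- exact: finite_finset.
- by move=> a b _ _ [x [/= <- <-]].
rewrite -(@bigfs _ _ _ _ (index_enum A)) ?index_enum_uniq // => a _.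
by rewrite mem_index_enum.
Qed.
End FiniteValued.

Section Cylinders.
Variable I : countType.
Implicit Types (F : {fset I}) (x y : cube I).

Definition coords F (x : cube I) : {ffun F -> bool} := [ffun i => x (val i)].

Definition extend F (a : {ffun F -> bool}) : cube I :=
  fun i => if insub i is Some j then a j else false.

Lemma extendK F a : coords F (extend a) = a.
Proof. by apply/ffunP => i; rewrite ffunE /extend valK. Qed.

Lemma coords_eqP F x y :
  coords F x = coords F y <-> (forall i, i \in F -> x i = y i).
Proof.
split=> [xy i iF|xy].
  by move/ffunP/(_ [` iF]%fset): xy; rewrite !ffunE.
by apply/ffunP => i; rewrite !ffunE xy // fsvalP.
Qed.

(** The sets containing all points that agree with x on some finite F form a
    filter, which converges to x in each coordinate. *)
Lemma open_coords (O : set (cube I)) x : open O -> O x ->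
  exists F, forall y, coords F y = coords F x -> O y.
Proof.
move=> oO Ox.
pose G : set_system (cube I) :=
  [set A | exists F, forall y, coords F y = coords F x -> A y].
have FG : Filter G.
  split.
  - by exists fset0.
  - move=> A B [FA hA] [FB hB]; exists (FA `|` FB)%fset => y /coords_eqP yx.
    split; [apply: hA | apply: hB]; apply/coords_eqP => i iF; apply: yx;
      by rewrite inE iF ?orbT.
  - by move=> A B AB [F hF]; exists F => y /hF; exact: AB.
suff : G --> x by apply; exact: open_nbhs_nbhs.
apply/cvg_sup => i A [B [[N oN NB] Bx] BA].
exists [fset i]%fset => y /coords_eqP yx; apply: BA; move: Bx; rewrite -NB /=.
by rewrite yx // inE.
Qed.

Definition cylinder F (a : {ffun F -> bool}) : set (cube I) :=
  coords F @^-1` [set a].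

Lemma open_cylinder F (a : {ffun F -> bool}) : open (cylinder a).
Proof.
rewrite openE => x xa; rewrite /interior /=.
have -> : cylinder a = \bigcap_(i in [set` F]) (proj i @^-1` [set x i]).
  by apply/seteqP; split=> y; rewrite /cylinder /= -xa => /coords_eqP.
apply: (@filter_bigI _ _ F _ (nbhs (x : cube I))) => i iF.
apply: (@proj_continuous I (fun=> bool) i x).
apply: open_nbhs_nbhs; split => //; exact: discrete_open.
Qed.

(** The empty set is added to make the cylinders stable under intersection: two
    of them may impose contradictory conditions. *)
Definition cylinder_or_empty : set (set (cube I)) :=
  [set A | A = set0 \/ exists F (a : {ffun F -> bool}), A = cylinder a].

Lemma cylinder_setI_closed : setI_closed cylinder_or_empty.
Proof.
move=> A B [->|[F [a ->]]]; first by left; rewrite set0I.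
move=> [->|[G [b ->]]]; first by left; rewrite setI0.
have [->|/set0P[x [xa xb]]] := eqVneq (cylinder a `&` cylinder b) set0.
  by left.
right; exists (F `|` G)%fset, (coords _ x); apply/seteqP; split=> y.
  move=> [ya yb]; apply/coords_eqP => i; rewrite inE => /orP[].
    by move=> iF; apply: (coords_eqP F y x).1 iF; rewrite ya xa.
  by move=> iG; apply: (coords_eqP G y x).1 iG; rewrite yb xb.
move=> /coords_eqP yx; split.
  rewrite /cylinder /= -xa; apply/coords_eqP => i iF.
  by apply: yx; rewrite inE iF.
rewrite /cylinder /= -xb; apply/coords_eqP => i iG.
by apply: yx; rewrite inE iG orbT.
Qed.

Lemma measurable_cylinder F (a : {ffun F -> bool}) :
  measurable (cylinder a : set (borel_cube I)).
Proof. by apply: sub_sigma_algebra; exact: open_cylinder. Qed.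

(** Countability of the index set enters here: it makes an open set a countable
    union of cylinders. *)
Lemma borel_cube_cylinderE :
  @measurable _ (borel_cube I) = <<s cylinder_or_empty >>.
Proof.
apply/seteqP; split; last first.
  apply: smallest_sub; first exact: sigma_algebra_measurable.
  move=> A [->|[F [a ->]]]; [exact: measurable0|exact: measurable_cylinder].
apply: smallest_sub; first exact: smallest_sigma_algebra.
move=> O oO.
have -> : O = \bigcup_(F : {fset I})
    \bigcup_(a in [set a : {ffun F -> bool} | cylinder a `<=` O]) cylinder a.
  apply/seteqP; split=> [x Ox|x [F _ [a aO ax]]]; last exact: aO.
  have [F hF] := open_coords oO Ox; exists F => //.
  by exists (coords F x) => //= y; exact: hF.
pose C := g_sigma_algebraType cylinder_or_empty.
apply: (@countable_bigcupT_measurable _ C); first exact: countableP.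
move=> F; apply: (@fin_bigcup_measurable _ C) => [|a _].
  exact: finite_finset.
by apply: sub_sigma_algebra; right; exists F, a.
Qed.

Lemma eq_measure_cylinder (R : realType)
    (m1 m2 : {measure set (borel_cube I) -> \bar R}) :
  (m1 setT < +oo)%E ->
  (forall F (a : {ffun F -> bool}), m1 (cylinder a) = m2 (cylinder a)) ->
  forall A, measurable A -> m1 A = m2 A.
Proof.
move=> m1T m12 A mA.
apply: (@measure_unique _ _ (borel_cube I)
  cylinder_or_empty (fun=> setT)) => //.
- exact: borel_cube_cylinderE.
- exact: cylinder_setI_closed.
- move=> _; right; exists fset0, (coords _ point).
  by apply/seteqP; split=> // x _; apply/coords_eqP.
- by rewrite bigcup_const //; exists 0%N.
- by move=> B [->|[F [a ->]]]; rewrite ?measure0.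
Qed.

Lemma measurable_fun_cube d (X : measurableType d) (f : X -> borel_cube I) :
  (forall F (a : {ffun F -> bool}), measurable (f @^-1` cylinder a)) ->
  measurable_fun setT f.
Proof.
move=> mf; apply: (@measurability _ _ _ (borel_cube I) _ _ cylinder_or_empty).
  exact: borel_cube_cylinderE.
by move=> _ [B [->|[F [a ->]]] <-]; rewrite setTI ?preimage_set0.
Qed.
End Cylinders.

(** * Masses of cylinders *)

Section Majority.
Variables (R : realType) (I : countType).
Variable mu : probability (borel_cube I) R.
Implicit Types F : {fset I}.

Definition mass F (a : {ffun F -> bool}) : R := fine (mu (cylinder a)).

Lemma massE F (a : {ffun F -> bool}) : mu (cylinder a) = (mass a)%:E.
Proof.
by rewrite /mass fineK // fin_num_measure //; exact: measurable_cylinder.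
Qed.

Lemma sum_mass F : \sum_(a : {ffun F -> bool}) mass a = 1.
Proof.
apply: EFin_inj; rewrite -(probability_setT mu) -sumEFin.
under eq_bigr do rewrite -massE.
rewrite -(@measure_preimage_fin _ _ _ _ mu (@coords I F)).
  by congr (mu _); apply/seteqP; split.
by move=> a; exact: measurable_cylinder.
Qed.

Definition coords3 F (p : borel_cube I * borel_cube I * borel_cube I) :=
  (coords F p.1.1, coords F p.1.2, coords F p.2).

Lemma coords3_fiber F c :
  coords3 F @^-1` [set c] =
  (cylinder c.1.1 `*` cylinder c.1.2) `*` cylinder c.2.
Proof.
case: c => [[a b] c]; apply/seteqP; split=> -[[x y] z] /=.
  by move=> [].
by move=> [[<- <-] <-].
Qed.

Lemma measurable_coords3_fiber F c : measurable (coords3 F @^-1` [set c]).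
Proof.
by rewrite coords3_fiber; do 2?apply: measurableX; exact: measurable_cylinder.
Qed.

Lemma cube_maj_cylinder F (a : {ffun F -> bool}) :
  @cube_maj I @^-1` cylinder a =
  coords3 F @^-1` [set c | ffun_maj c.1.1 c.1.2 c.2 == a].
Proof.
rewrite /cylinder; apply/seteqP; split=> p /= => [<-|/eqP <-].
  by apply/eqP/ffunP => i; rewrite !ffunE.
by apply/ffunP => i; rewrite !ffunE.
Qed.

Lemma measurable_cube_maj : measurable_fun setT (@cube_maj I).
Proof.
apply: measurable_fun_cube => F a; rewrite cube_maj_cylinder.
by apply: measurable_preimage_fin => c; exact: measurable_coords3_fiber.
Qed.

(** The preimage of a cylinder over F under majority depends on the coordinates
    in F only, so it splits into finitely many products of three cylinders. *)
Lemma pushforward_maj_cylinder F (a : {ffun F -> bool}) :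
  pushforward (mu \x mu \x mu)%E (@cube_maj I) (cylinder a) =
  (\sum_u \sum_v \sum_(w | ffun_maj u v w == a) mass u * mass v * mass w)%:E.
Proof.
rewrite /pushforward cube_maj_cylinder measure_preimage_fin; last first.
  exact: measurable_coords3_fiber.
rewrite (eq_bigr (fun c => (mass c.1.1 * mass c.1.2 * mass c.2)%:E));
  last first.
  move=> [[u v] w] _; rewrite coords3_fiber.
  rewrite [LHS]product_measure1E; last 2 first.
  - by apply: measurableX; exact: measurable_cylinder.
  - exact: measurable_cylinder.
  by rewrite [X in (X * _)%E]product_measure1E /= ?massE //;
    exact: measurable_cylinder.
rewrite sumEFin; congr _%:E.
by rewrite pair_bigA pair_big_dep /=; apply: eq_big => // -[[]].
Qed.

Lemma balanced_mass : balanced mu -> forall F, balanced_weight (@mass F).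
Proof.
move=> bmu F a; apply: EFin_inj; rewrite -massE -bmu; last first.
  exact: measurable_cylinder.
by rewrite pushforward_maj_cylinder.
Qed.

Lemma uniform_mass_balanced :
  (forall F (a : {ffun F -> bool}), mass a = 2^-1 ^+ #|{: F}|) -> balanced mu.
Proof.
move=> umu A mA.
pose mm := (mu \x mu \x mu)%E.
unshelve refine
  (@eq_measure_cylinder _ _ (pushforward mm (@cube_maj I)) mu _ _ A mA).
- exact: measurable_cube_maj.
- rewrite [ltLHS](_ : _ = mm ((setT `*` setT) `*` setT)); last first.
    by rewrite !setXTT.
  rewrite [ltLHS]product_measure1E //; last exact: measurableX.
  rewrite [X in (X * _)%E]product_measure1E //= !probability_setT.
  by rewrite !mule1 ltry.
- move=> F a; transitivity (mass a)%:E; last by rewrite -massE.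
  rewrite umu [LHS]pushforward_maj_cylinder.
  congr _%:E; rewrite -[RHS](@uniform_weight_balanced R _ a).
  by do !(apply: eq_bigr => ? _); rewrite !umu.
Qed.

Lemma mass_gt0 F (a : {ffun F -> bool}) : fully_supported mu -> 0 < mass a.
Proof.
move=> [_ _ suppT]; rewrite lt_neqAle -lee_fin -massE measure_ge0 andbT.
apply/negP => /eqP a0.
have : setT `<=` ~` cylinder a.
  apply: suppT; first by apply: open_closedC; exact: open_cylinder.
  by rewrite setCK massE -a0.
by move=> /(_ (extend a) Logic.I); apply; exact: extendK.
Qed.

Lemma fully_supported_mass_gt0 :
  (forall F (a : {ffun F -> bool}), 0 < mass a) -> fully_supported mu.
Proof.
move=> mu0; split; first exact: closedT.
  by rewrite setCT measure0.
move=> C cC muC x _; apply: contrapT => Cx.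
have [F hF] := open_coords (closed_openC cC) Cx.
have := mu0 F (coords F x); rewrite -lte_fin -massE ltNge => /negP; apply.
apply: (@le_trans _ _ (mu (~` C))); last by rewrite muC.
apply: le_measure.
- by apply/mem_set; exact: measurable_cylinder.
- by apply/mem_set; apply: sub_sigma_algebra; exact: closed_openC.
- by move=> y; exact: hF.
Qed.

End Majority.

Lemma bernoulli_halfE (R : realType) (A : set bool) :
  bernoulli_prob (2^-1 : R) A = (\sum_(b : bool) (b \in A)%:R * 2^-1)%:E.
Proof.
rewrite bernoulli_probE; last by apply/andP; split; lra.
rewrite !diracE /unstable.onem big_bool /= -!EFinM -EFinD; congr _%:E.
by lra.
Qed.

Lemma uniform_mass (R : realType) (I : countType)
    (mu : probability (borel_cube I) R) : is_uniform mu ->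
  forall (F : {fset I}) (a : {ffun F -> bool}), mass mu a = 2^-1 ^+ #|{: F}|.
Proof.
move=> umu F a; apply: EFin_inj; rewrite -massE.
have := umu F (fun i => [set extend a i]).
rewrite (_ : [set x | _] = cylinder a); last first.
  rewrite -[a in RHS]extendK; apply/seteqP; split=> x.
    by move=> xa; apply/coords_eqP.
  by move=> /coords_eqP.
move=> ->; rewrite (eq_bigr (fun=> (2^-1)%:E)) => [|i _].
  by rewrite prodEFin big_seq_fsetE /= prodr_const.
rewrite [LHS]bernoulli_halfE big_bool; congr _%:E.
rewrite !classical_sets.in_set1.
by case: (extend a i); rewrite /= mul1r mul0r ?addr0 ?add0r.
Qed.

(** * The uniform measure from binary digits *)

Section Existence.
Variable (R : realType).

Definition digit (k : nat) (x : R) : bool := odd (Num.truncn (2 ^+ k.+1 * x)).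

Definition dyadic (n j : nat) : set R := `[j%:R / 2 ^+ n, j.+1%:R / 2 ^+ n[.

Lemma dyadicE n j x : dyadic n j x <-> j%:R <= 2 ^+ n * x < j.+1%:R.
Proof.
rewrite /dyadic /= in_itv /= ler_pdivrMr ?exprn_gt0// ltr_pdivlMr ?exprn_gt0//.
by rewrite mulrC.
Qed.

Lemma truncn_dyadic n j x : 0 <= x ->
  (Num.truncn (2 ^+ n * x) = j <-> dyadic n j x).
Proof.
move=> x0; rewrite dyadicE -truncn_eq ?mulr_ge0 ?exprn_ge0 //.
by split=> /eqP.
Qed.

Definition digits n (x : R) : {ffun 'I_n -> bool} :=
  [ffun k => digit (val k) x].

(** Each further digit selects one half of the dyadic interval obtained so far:
    the left one for 0, the right one for 1. *)
Lemma digits_fiber n (w : {ffun 'I_n -> bool}) : exists j : nat,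
  digits n @^-1` [set w] `&` `[0, 1[ = dyadic n j.
Proof.
suff [j hj] : exists j : nat, forall x : R,
    (0 <= x < 1 /\ forall k : 'I_n, digit k x = w k) <-> dyadic n j x.
  exists j; apply/seteqP; split=> x.
    move=> [/= xw]; rewrite in_itv /= => x01; apply/hj; split=> // k.
    by rewrite -xw ffunE.
  move=> /hj[x01 xw]; split; last by rewrite /= in_itv.
  change (digits n x = w); apply/ffunP => k; rewrite ffunE; exact: xw.
elim: n w => [|n IH] w.
  exists 0%N => x; rewrite dyadicE expr0 mul1r.
  by split=> [[x01 _]|x01]; [exact: x01 | split; [exact: x01 | case]].
have [j hj] := IH [ffun k => w (widen_ord (leqnSn n) k)].
exists (j.*2 + w ord_max)%N => x.
have -> : (0 <= x < 1 /\ (forall k : 'I_n.+1, digit k x = w k)) <->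
    (dyadic n j x /\ digit n x = w ord_max).
  rewrite -hj; split=> [[x01 xw]|[[x01 xw] xn]].
    split; last exact: (xw ord_max).
    by split=> // k; rewrite ffunE -xw.
  split=> // k; have [kn|kn] := ltnP k n.
    have -> : k = widen_ord (leqnSn n) (Ordinal kn) by apply/val_inj.
    by have := xw (Ordinal kn); rewrite ffunE => <-.
  have -> // : k = ord_max.
  by apply/val_inj/eqP; rewrite /= eqn_leq kn -ltnS ltn_ord.
rewrite !dyadicE exprS /digit.
set y := 2 ^+ n * x; have -> : 2 ^+ n.+1 * x = 2 * y by rewrite exprS mulrA.
have -> : 2 * 2 ^+ n * x = 2 * y by rewrite mulrA.
rewrite -[j.+1]addn1 -[(_ + _).+1]addn1 !natrD -mul2n natrM.
split=> [[/andP[jy yj] wy]|].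
  have y0 : 0 <= 2 * y by apply: mulr_ge0 => //; apply: le_trans jy.
  have := truncn_itv y0; rewrite -wy; move: (Num.truncn _) => t /andP[].
  rewrite -[t.+1]addn1 natrD => ty yt.
  have tE : t = (j.*2 + odd t)%N.
    have h1 : (t < j.*2.+2)%N.
      by rewrite -(ltr_nat R) -addn2 natrD -mul2n natrM; lra.
    have h2 : (j.*2 < t.+1)%N.
      by rewrite -(ltr_nat R) -addn1 natrD -mul2n natrM; lra.
    by have := odd_double_half t; case: (odd t) => /=; lia.
  have tE' : t%:R = 2 * j%:R + (odd t)%:R :> R.
    by rewrite {1}tE natrD -mul2n natrM.
  by lra.
move=> /andP[jy yj].
have y0 : 0 <= 2 * y by apply: le_trans jy; rewrite addr_ge0 ?mulr_ge0.
have : Num.truncn (2 * y) = (j.*2 + w ord_max)%N.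
  apply/eqP; rewrite truncn_eq // -[(_ + _).+1]addn1 !natrD -mul2n natrM.
  by apply/andP; split.
move=> ->; split; last by rewrite oddD odd_double; case: (w _).
by case: (w ord_max) jy yj => /= ? ?; apply/andP; split; lra.
Qed.

Lemma lebesgue_digits n (w : {ffun 'I_n -> bool}) :
  lebesgue_measure (digits n @^-1` [set w] `&` `[0, 1[) = (2^-1 ^+ n : R)%:E.
Proof.
have [j ->] := digits_fiber w; rewrite /dyadic lebesgue_measure_itv /= lte_fin.
have n0 : 0 < (2 : R) ^+ n by rewrite exprn_gt0.
rewrite ltr_pM2r ?invr_gt0 // ltr_nat ltnSn -EFinD; congr _%:E.
by rewrite -mulrBl -[j.+1]addn1 natrD addrC addrA addNr add0r mul1r exprVn.
Qed.

Lemma measurable_digit k b : measurable (digit k @^-1` [set b] : set R).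
Proof.
have -> : digit k @^-1` [set b] = \bigcup_(m in [set m | odd m = b])
  [set x | Num.truncn (2 ^+ k.+1 * x) = m].
  apply/seteqP; split=> [x xb|x [m /= <- <-]//].
  by exists (Num.truncn (2 ^+ k.+1 * x)).
apply: bigcup_measurable => m _.
have k0 : 0 < (2 : R) ^+ k.+1 by rewrite exprn_gt0.
(* Truncation sends all negative reals to 0, hence the half-line when m = 0. *)
have -> : [set x | Num.truncn (2 ^+ k.+1 * x) = m] =
   (dyadic k.+1 m `&` `[0, +oo[) `|` (if m == 0%N then `]-oo, 0[ else set0).
  apply/seteqP; split=> x /=.
    have [x0 xm|x0] := leP 0 x.
      by left; rewrite in_itv /= x0; split=> //; exact/truncn_dyadic.
    rewrite truncn_floor leNgt pmulr_rlt0 // x0.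
    by move=> <-; right; rewrite eqxx /= in_itv.
  move=> [[xm]|]; first by rewrite in_itv /= andbT => x0; apply/truncn_dyadic.
  case: eqP => // -> /=; rewrite in_itv /= => x0.
  by rewrite truncn_floor leNgt pmulr_rlt0 // x0.
apply: measurableU; first by apply: measurableI; exact: measurable_itv.
by case: ifP => _; [exact: measurable_itv|exact: measurable0].
Qed.

Lemma measurable_digits_fiber n (w : {ffun 'I_n -> bool}) :
  measurable (digits n @^-1` [set w]).
Proof.
have -> : digits n @^-1` [set w] =
    \bigcap_(k in [set: 'I_n]) (@digit (val k) @^-1` [set w k]).
  apply/seteqP; split=> x.
    by move=> <- k _ /=; rewrite ffunE.
  move=> xw; change (digits n x = w); apply/ffunP => k; rewrite ffunE.
  exact: (xw k Logic.I).
apply: fin_bigcap_measurable => [|k _]; first exact: finite_finset.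
exact: measurable_digit.
Qed.

Definition unit_lebesgue :=
  mrestr (@lebesgue_measure R) (measurable_itv `[(0 : R), 1[%R).

HB.instance Definition _ := Measure.copy unit_lebesgue
  (mrestr (@lebesgue_measure R) (measurable_itv `[(0 : R), 1[%R)).

Let unit_lebesgue_setT : unit_lebesgue setT = 1%E.
Proof.
rewrite /unit_lebesgue /mrestr setTI.
by rewrite lebesgue_measure_itv /= lte_fin ltr01 oppr0 adde0.
Qed.

HB.instance Definition _ := Measure_isProbability.Build _ _ _ unit_lebesgue
  unit_lebesgue_setT.

(** Any n digits of a uniform point are independent fair bits, since the fibers
    of [digits n] all have the same mass 2^-n. *)
Lemma unit_lebesgue_digits n (ok : 'I_n -> set bool) :
  unit_lebesgue [set x | forall k : 'I_n, ok k (digit k x)] =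
  (\prod_k \sum_(b : bool) (b \in ok k)%:R * 2^-1)%:E.
Proof.
have -> : [set x | forall k : 'I_n, ok k (digit k x)] =
    digits n @^-1` [set w : {ffun 'I_n -> bool} | [forall k, w k \in ok k]].
  apply/seteqP; split=> x /=.
    by move=> okx; apply/forallP => k; rewrite ffunE; apply/mem_set/okx.
  by move=> /forallP okx k; have := okx k; rewrite ffunE => /set_mem.
rewrite [LHS](measure_preimage_fin unit_lebesgue (@measurable_digits_fiber n)).
rewrite bigA_distr_bigA /= -sumEFin big_mkcond; apply: eq_bigr => w _.
rewrite [X in if _ then X else _]lebesgue_digits.
rewrite big_split /= prodr_const card_ord.
case: ifPn => [/forallP okw|].
  by rewrite big1 ?mul1r // => k _; rewrite okw.
by move=> /forallPn[k /negbTE wk]; rewrite (bigD1 k) //= wk !mul0r.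
Qed.

Section PullBack.
Variable I : countType.

Definition binary_expansion (x : measurableTypeR R) : borel_cube I :=
  fun i => digit (choice.pickle i) x.

Lemma measurable_binary_expansion : measurable_fun setT binary_expansion.
Proof.
apply: measurable_fun_cube => F a.
have -> : binary_expansion @^-1` cylinder a =
    \bigcap_(i in [set: F]) (@digit (choice.pickle (val i)) @^-1` [set a i]).
  apply/seteqP; split=> x.
    by move=> <- i _ /=; rewrite ffunE.
  move=> xa; change (coords F (binary_expansion x) = a).
  by apply/ffunP => i; rewrite ffunE; exact: (xa i Logic.I).
apply: fin_bigcap_measurable => [|k _]; first exact: finite_finset.
exact: measurable_digit.
Qed.

HB.instance Definition _ := isMeasurableFun.Build _ _ _ _ binary_expansion
  measurable_binary_expansion.

Definition uniform_cube : probability (borel_cube I) R :=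
  distribution unit_lebesgue binary_expansion.

(** A box in the cube is a condition on the first n digits, for n larger than
    all codes of coordinates in F. The digits whose rank codes no element of F
    are unconstrained and contribute factors 1. *)
Lemma uniform_cube_uniform : is_uniform uniform_cube.
Proof.
move=> F A.
have [n Fn] : exists n, forall i, i \in F -> (choice.pickle i < n)%N.
  exists (\max_(i <- F) choice.pickle i).+1 => i iF.
  by rewrite ltnS; apply: leq_bigmax_seq.
pose ok k := [set b | forall i, i \in F -> choice.pickle i = k -> A i b].
transitivity (unit_lebesgue [set x | forall k : 'I_n, ok k (digit k x)]).
  congr (unit_lebesgue _).
  apply/seteqP; split=> x /= Ax; first by move=> k i iF <-; exact: Ax.
  by move=> i iF; exact: (Ax (Ordinal (Fn i iF)) i).
rewrite (unit_lebesgue_digits (fun k : 'I_n => ok k)).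
pose G (B : set bool) : R := \sum_(b : bool) (b \in B)%:R * 2^-1.
rewrite (eq_big_seq (fun i => (G (ok (choice.pickle i)))%:E)) => [|i iF];
  last first.
  rewrite [LHS]bernoulli_halfE; congr (G _)%:E; apply/seteqP; split=> b.
    by move=> Ab i' _ /(pcan_inj (@choice.pickleK _)) ->.
  by apply.
rewrite prodEFin; congr _%:E.
rewrite -[RHS](big_map choice.pickle predT (fun k => G (ok k))).
rewrite -[LHS]/(\prod_(k < n) G (ok k)) -(big_mkord xpredT (fun k => G (ok k))).
rewrite (bigID [in map choice.pickle F]) /= [X in _ * X]big1 ?mulr1 => [|k kF];
  last first.
  rewrite /G big_bool !mem_set /=; first by lra.
    by move=> i iF ki; rewrite -ki map_f in kF.
  by move=> i iF ki; rewrite -ki map_f in kF.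
rewrite -big_filter; apply: perm_big; apply: uniq_perm.
- by rewrite filter_uniq // iota_uniq.
- by rewrite map_inj_uniq ?fset_uniq //; exact: pcan_inj (@choice.pickleK _).
move=> k; rewrite mem_filter mem_index_iota /=.
by apply: andb_idr => /mapP[i iF ->]; exact: Fn.
Qed.

End PullBack.

End Existence.

Theorem proposition1p2 (R : realType) (I : countType) :
  (exists lambda : probability (borel_cube I) R, is_uniform lambda) /\
  (forall lambda : probability (borel_cube I) R, is_uniform lambda ->
    [/\ balanced lambda,
        fully_supported lambda &
        forall mu : probability (borel_cube I) R,
          balanced mu -> fully_supported mu ->
          forall A : set (borel_cube I), measurable A -> mu A = lambda A]).
Proof.
split; first by exists (uniform_cube R I); exact: uniform_cube_uniform.
move=> lambda /uniform_mass massl; split.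
- exact: uniform_mass_balanced.
- by apply: fully_supported_mass_gt0 => F a; rewrite massl exprn_gt0 ?invr_gt0.
move=> mu bmu smu A mA; apply: eq_measure_cylinder => //.
  by rewrite /= probability_setT ltry.
move=> F a; rewrite /= [LHS]massE [RHS]massE.
congr _%:E; rewrite massl.
rewrite (balanced_weight_uniform _ _ (@balanced_mass _ _ _ bmu F)) //.
  by move=> u; exact: mass_gt0.
exact: sum_mass.
Qed.
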